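(* Let $\mu,c\in\mathbb{C}$ with $|\mu|\leq 1$, and let $\Upsilon(z)=K_c(z)$ and $\Phi(z)=\mu z$ for $z\in\mathbb{C}$, such that $C_{\Upsilon,\Phi}$ is bounded on $H_E(\xi)$. Then $C_{\Upsilon,\Phi}$ is an isometry on $H_E(\xi)$ if and only if $|\mu|=1$, $c=0$ and $\xi_0=1$. Moreover, $C_{\Upsilon,\Phi}$ is unitary on $H_E(\xi)$ if and only if $|\mu|=1$, $c=0$ and $\xi_0=1$.
   Context: Let $\xi=(\xi_n)_{n\ge 0}$ be a sequence of positive real numbers with $\lim_{n\to\infty}\xi_n^{1/n}=\infty$. $H_E(\xi)$ is the Hilbert space of entire functions $f(z)=\sum_{n=0}^\infty a_n z^n$ with $\|f\|^2=\sum_{n=0}^\infty |a_n|^2\xi_n^2<\infty$, with inner product $\langle f,g\rangle=\sum_{n=0}^\infty b_n\overline{c_n}\,\xi_n^2$ for $f=\sum b_nz^n$, $g=\sum c_nz^n$. For $p\in\mathbb{C}$, $K_p(z)=\sum_{n=0}^\infty \frac{1}{\xi_n^2}\overline{p}^{\,n}z^n$ is the reproducing kernel, satisfying $f(p)=\langle f,K_p\rangle$ for all $f\in H_E(\xi)$. For entire functions $\Upsilon,\Phi$, the weighted composition operator is $C_{\Upsilon,\Phi}f=\Upsilon\cdot(f\circ\Phi)$. A bounded operator $S$ is an isometry if $\|Sx\|=\|x\|$ for all $x$ (equivalently $S^*S=I$), and unitary if $S^*S=SS^*=I$. *)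

(* Defs.v *)
From Stdlib Require Export Reals.
From Stdlib Require Import ClassicalEpsilon.
From Coquelicot Require Export Coquelicot.

Local Open Scope R_scope.

(** Sum of a convergent complex series (unspecified if the series diverges). *)
Definition CSeries (a : nat -> C) : C :=
  iota (fun l : C_CompleteNormedModule => is_series a l).

Lemma CSeries_unique (a : nat -> C) (l : C) :
  is_series (V := C_CompleteNormedModule) a l -> CSeries a = l.
Proof.
  intros Hl. unfold CSeries.
  apply (iota_unique (V := C_CompleteNormedModule)); [|exact Hl].
  intros y Hy.
  exact (filterlim_locally_unique (V := C_CompleteNormedModule) _ y l Hy Hl).
Qed.

(** [f] is entire, with [f z = sum_n a_n z^n] on the whole plane. *)
Definition has_expansion (f : C -> C) (a : nat -> C) : Prop :=
  forall z : C, is_series (V := C_NormedModule) (fun n => Cmult (a n) (Cpow z n)) (f z).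

(** The coefficients of an entire function, determined by [f] through the
    uniqueness of power series expansions (unspecified if [f] is not entire). *)
Definition coeff (f : C -> C) : nat -> C :=
  epsilon (inhabits (fun _ => RtoC 0)) (has_expansion f).

Section HilbertSpaceOfEntireFunctions.

Variable xi : nat -> R.

Definition in_HE (f : C -> C) : Prop :=
  exists a : nat -> C,
    has_expansion f a /\ ex_series (fun n => Cmod (a n) ^ 2 * xi n ^ 2).

Definition HE_norm (f : C -> C) : R :=
  sqrt (Series (fun n => Cmod (coeff f n) ^ 2 * xi n ^ 2)).

Definition HE_inner (f g : C -> C) : C :=
  CSeries (fun n =>
    Cmult (Cmult (coeff f n) (Cconj (coeff g n))) (RtoC (xi n ^ 2))).

Definition HE_kernel (p z : C) : C :=
  CSeries (fun n =>
    Cmult (Cmult (RtoC (/ xi n ^ 2)) (Cpow (Cconj p) n)) (Cpow z n)).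

(** Operators are maps on all functions [C -> C]; only their restriction to
    the space [in_HE] matters in the definitions below. *)
Definition bounded_operator (S : (C -> C) -> C -> C) : Prop :=
  (forall f, in_HE f -> in_HE (S f)) /\
  (forall (a b : C) f g, in_HE f -> in_HE g -> forall z,
     S (fun w => Cplus (Cmult a (f w)) (Cmult b (g w))) z
     = Cplus (Cmult a (S f z)) (Cmult b (S g z))) /\
  (exists M : R, forall f, in_HE f -> HE_norm (S f) <= M * HE_norm f).

Definition is_adjoint (S T : (C -> C) -> C -> C) : Prop :=
  bounded_operator T /\
  forall f g, in_HE f -> in_HE g -> HE_inner (S f) g = HE_inner f (T g).

Definition isometry (S : (C -> C) -> C -> C) : Prop :=
  bounded_operator S /\ forall f, in_HE f -> HE_norm (S f) = HE_norm f.

Definition unitary (S : (C -> C) -> C -> C) : Prop :=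
  bounded_operator S /\
  exists T, is_adjoint S T /\
    (forall f, in_HE f -> forall z, T (S f) z = f z) /\
    (forall f, in_HE f -> forall z, S (T f) z = f z).

End HilbertSpaceOfEntireFunctions.

Definition weighted_comp (Upsilon Phi : C -> C) (f : C -> C) : C -> C :=
  fun z => Cmult (Upsilon z) (f (Phi z)).

(* Main.v *)
(** If [S] is an isometry then [mu <> 0], by comparing the images of [1] and
    [1 + z].  The vectors [1 + t z] and [1 - t z] have equal norms, hence so
    have [K_c (1 + t mu z)] and [K_c (1 - t mu z)].  For [t = conj c / mu] every
    cross term in the difference of their squared norms is nonnegative, so all
    vanish, which forces [c = 0].  Then [S f z = f (mu z) / xi_0^2], and the norms
    of the images of [1] and [1 + z] give [xi_0 = 1] and [|mu| = 1].
    Conversely, under these conditions [S] is the rotation [f z -> f (mu z)],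
    whose inverse and adjoint is the rotation by [conj mu]. *)

Require Import Defs.
From Stdlib Require Import Reals.
From Coquelicot Require Import Coquelicot.
From Stdlib Require Import ClassicalEpsilon FunctionalExtensionality Lra Lia.
Local Open Scope R_scope.

(** * Convergent series: images under additive maps, finite sums, nonnegative terms *)

(** Additivity lets [h] commute with partial sums, and continuity at [l] carries the limit across.
    The two scalar rings may differ, so that [Re], [Im] and [RtoC] are all covered. *)
Lemma is_series_additive {K L : AbsRing} {V : NormedModule K}
  {W : NormedModule L} (h : V -> W) (a : nat -> V) (l : V) :
  (forall x y, h (plus x y) = plus (h x) (h y)) ->
  filterlim h (locally l) (locally (h l)) ->
  is_series a l -> is_series (fun n => h (a n)) (h l).
Proof.
  intros Hadd Hcont Ha.
  apply (filterlim_ext (fun n => h (sum_n a n))).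
  - intros n. induction n as [|n IH].
    + now rewrite !sum_O.
    + now rewrite !sum_Sn, <- IH.
  - exact (filterlim_comp _ _ _ (sum_n a) h _ (locally l) _ Ha Hcont).
Qed.

Lemma is_series_Re (a : nat -> C) (l : C) :
  is_series (V := C_NormedModule) a l ->
  is_series (V := R_NormedModule) (fun n => Re (a n)) (Re l).
Proof.
  apply (is_series_additive (V := C_NormedModule) (W := R_NormedModule) Re).
  - reflexivity.
  - intros P [eps HP]. exists eps. intros y [Hy _]. now apply HP.
Qed.

Lemma is_series_Im (a : nat -> C) (l : C) :
  is_series (V := C_NormedModule) a l ->
  is_series (V := R_NormedModule) (fun n => Im (a n)) (Im l).
Proof.
  apply (is_series_additive (V := C_NormedModule) (W := R_NormedModule) Im).
  - reflexivity.
  - intros P [eps HP]. exists eps. intros y [_ Hy]. now apply HP.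
Qed.

Lemma is_series_RtoC (a : nat -> R) (l : R) :
  is_series (V := R_NormedModule) a l ->
  is_series (V := C_NormedModule) (fun n => RtoC (a n)) (RtoC l).
Proof.
  apply (is_series_additive (V := R_NormedModule) (W := C_NormedModule) RtoC).
  - exact RtoC_plus.
  - intros P [eps HP]. exists eps. intros y Hy. apply HP.
    split; [exact Hy | apply ball_center].
Qed.

Lemma is_series_first {K : AbsRing} {V : NormedModule K} (a : nat -> V) :
  (forall n, a (S n) = zero) -> is_series a (a 0%nat).
Proof.
  intros Ha. apply (filterlim_ext (fun _ => a 0%nat)).
  - intros n. induction n as [|n IH].
    + now rewrite sum_O.
    + now rewrite sum_Sn, <- IH, Ha, plus_zero_r.
  - apply filterlim_const.
Qed.

Lemma is_series_first_two (a : nat -> R) :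
  (forall n, a (S (S n)) = 0) -> is_series a (a 0%nat + a 1%nat).
Proof.
  intros Ha. apply is_series_decr_1.
  replace (plus _ _) with (a 1%nat) by (unfold plus, opp; simpl; ring).
  now apply (is_series_first (fun n => a (S n))).
Qed.

(** Each term is at most a partial sum, and each partial sum is at most the total, which is zero. *)
Lemma nonneg_series_zero (a : nat -> R) :
  (forall n, 0 <= a n) -> is_series a 0 -> forall n, a n = 0.
Proof.
  intros Hpos Ha n.
  assert (H : sum_n a n <= 0).
  { rewrite <- (is_series_unique _ _ Ha). rewrite sum_n_Reals.
    apply (sum_incr a n); [|exact Hpos].
    apply is_lim_seq_Reals. rewrite (is_series_unique _ _ Ha).
    apply (is_lim_seq_ext (sum_n a)); [|exact Ha].
    intros k. apply sum_n_Reals. }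
  assert (G : a n <= sum_n a n).
  { destruct n as [|n].
    - rewrite sum_O. lra.
    - rewrite sum_Sn. unfold plus; simpl.
      assert (0 <= sum_n a n) by (rewrite sum_n_Reals; now apply cond_pos_sum).
      lra. }
  specialize (Hpos n). lra.
Qed.

(** * Uniqueness of power series coefficients *)

(** Convergence at the point 1 makes the coefficients bounded, so the radius is at least 1. *)
Lemma CV_radius_pos (a : nat -> R) :
  ex_series a -> Rbar_lt 0 (CV_radius a).
Proof.
  intros Ha.
  apply Rbar_lt_le_trans with (Finite 1); [simpl; lra|].
  apply (proj1 (CV_radius_bounded a)).
  destruct (filterlim_bounded a) as [M HM].
  - exists 0. exact (ex_series_lim_0 _ Ha).
  - exists M. intros n. rewrite pow1, Rmult_1_r. exact (HM n).
Qed.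

Lemma real_power_series_unique (a b : nat -> R) (f : R -> R) :
  (forall x, is_series (fun n => a n * x ^ n) (f x)) ->
  (forall x, is_series (fun n => b n * x ^ n) (f x)) ->
  forall n, a n = b n.
Proof.
  assert (Hpos : forall u : nat -> R,
    (forall x, is_series (fun n => u n * x ^ n) (f x)) ->
    Rbar_lt 0 (CV_radius u)).
  { intros u Hu. apply CV_radius_pos. exists (f 1).
    generalize (Hu 1). apply is_series_ext.
    intros n. rewrite pow1. apply Rmult_1_r. }
  intros Ha Hb n. apply PSeries_ext_recip; [now apply Hpos | now apply Hpos |].
  apply filter_forall. intros x. unfold PSeries.
  now rewrite (is_series_unique _ _ (Ha x)), (is_series_unique _ _ (Hb x)).
Qed.

(** On the real axis the powers of [x] are real, so the real part of the expansion is a real power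
    series. With the analogue for [Im], complex uniqueness reduces to the real one. *)
Lemma has_expansion_Re (f : C -> C) (a : nat -> C) :
  has_expansion f a ->
  forall x : R, is_series (fun n => Re (a n) * x ^ n) (Re (f (RtoC x))).
Proof.
  intros Ha x. generalize (is_series_Re _ _ (Ha (RtoC x))). apply is_series_ext.
  intros n. rewrite <- RtoC_pow. unfold Re, Im; simpl. ring.
Qed.

Lemma has_expansion_Im (f : C -> C) (a : nat -> C) :
  has_expansion f a ->
  forall x : R, is_series (fun n => Im (a n) * x ^ n) (Im (f (RtoC x))).
Proof.
  intros Ha x. generalize (is_series_Im _ _ (Ha (RtoC x))). apply is_series_ext.
  intros n. rewrite <- RtoC_pow. unfold Re, Im; simpl. ring.
Qed.

Lemma has_expansion_unique (f : C -> C) (a b : nat -> C) :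
  has_expansion f a -> has_expansion f b -> a = b.
Proof.
  intros Ha Hb. apply functional_extensionality. intros n.
  rewrite (surjective_pairing (a n)), (surjective_pairing (b n)). f_equal.
  - exact (real_power_series_unique _ _ (fun x => Re (f (RtoC x)))
      (has_expansion_Re _ _ Ha) (has_expansion_Re _ _ Hb) n).
  - exact (real_power_series_unique _ _ (fun x => Im (f (RtoC x)))
      (has_expansion_Im _ _ Ha) (has_expansion_Im _ _ Hb) n).
Qed.

(** By uniqueness, the expansion picked by [epsilon] is whichever one is at hand; this is how
    [coeff] gets computed. *)
Lemma coeff_eq (f : C -> C) (a : nat -> C) :
  has_expansion f a -> coeff f = a.
Proof.
  intros Ha. apply (has_expansion_unique f); [|exact Ha].
  unfold coeff. apply epsilon_spec. now exists a.
Qed.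

(** * Expansions of products with $1+sz$, of constants and of rotations *)

Lemma has_expansion_ext (f g : C -> C) (a : nat -> C) :
  (forall z, f z = g z) -> has_expansion f a -> has_expansion g a.
Proof. intros Hfg Ha z. rewrite <- Hfg. apply Ha. Qed.

(* The coefficients of [(1 + s z) f z] when [f] has coefficients [a]. *)
Definition affine_coeff (s : C) (a : nat -> C) (n : nat) : C :=
  Cplus (a n) (Cmult s (match n with O => RtoC 0 | S m => a m end)).

Lemma has_expansion_affine (f : C -> C) (a : nat -> C) (s : C) :
  has_expansion f a ->
  has_expansion (fun z => Cmult (f z) (Cplus (RtoC 1) (Cmult s z)))
    (affine_coeff s a).
Proof.
  intros Ha z.
  (* Multiplication by $sz$ shifts the coefficients by one place; the new zeroth coefficient is
     0. *)
  assert (Hshift : is_series (V := C_NormedModule)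
    (fun n => Cmult (match n with O => RtoC 0 | S m => Cmult s (a m) end)
                (Cpow z n)) (Cmult (Cmult s z) (f z))).
  { apply is_series_decr_1.
    replace (plus _ _) with (Cmult (Cmult s z) (f z))
      by (unfold plus, opp; simpl; ring).
    generalize (is_series_scal (V := C_NormedModule) (Cmult s z) _ _ (Ha z)).
    apply is_series_ext. intros n. rewrite Cpow_S. unfold scal; simpl.
    unfold mult; simpl. ring. }
  generalize (is_series_plus _ _ _ _ (Ha z) Hshift).
  replace (plus _ _) with (Cmult (f z) (Cplus (RtoC 1) (Cmult s z)))
    by (unfold plus; simpl; ring).
  apply is_series_ext. intros [|n]; unfold plus, affine_coeff; simpl; ring.
Qed.

Definition delta (n : nat) : C := match n with O => RtoC 1 | S _ => RtoC 0 end.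

Lemma has_expansion_one : has_expansion (fun _ => RtoC 1) delta.
Proof.
  intros z.
  replace ((fun _ => RtoC 1) z) with (Cmult (delta 0) (Cpow z 0))
    by apply Cmult_1_l.
  apply (is_series_first (V := C_NormedModule)
           (fun n => Cmult (delta n) (Cpow z n))).
  intros n. apply Cmult_0_l.
Qed.

Lemma has_expansion_rotate (f : C -> C) (a : nat -> C) (mu : C) :
  has_expansion f a ->
  has_expansion (fun z => f (Cmult mu z)) (fun n => Cmult (a n) (Cpow mu n)).
Proof.
  intros Ha z. generalize (Ha (Cmult mu z)). apply is_series_ext.
  intros n. rewrite Cpow_mult_l. apply Cmult_assoc.
Qed.

Lemma pow2_eq_1 (x : R) : 0 <= x -> x ^ 2 = 1 -> x = 1.
Proof. intros Hx H. nra. Qed.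

(** * Norm and inner product in terms of coefficients *)

Section HE.

Variable xi : nat -> R.
Hypothesis xi_pos : forall n, 0 < xi n.

Definition norm_terms (a : nat -> C) (n : nat) : R := Cmod (a n) ^ 2 * xi n ^ 2.

Lemma norm_terms_ge_0 (a : nat -> C) (n : nat) : 0 <= norm_terms a n.
Proof. apply Rmult_le_pos; apply pow2_ge_0. Qed.

Lemma in_HE_coeff (f : C -> C) :
  in_HE xi f ->
  has_expansion f (coeff f) /\ ex_series (norm_terms (coeff f)).
Proof. intros [a [Ha Hs]]. now rewrite (coeff_eq f a Ha). Qed.

Lemma HE_norm_sqr (f : C -> C) (a : nat -> C) :
  in_HE xi f -> has_expansion f a ->
  is_series (norm_terms a) (HE_norm xi f ^ 2).
Proof.
  intros Hf Ha. destruct (in_HE_coeff f Hf) as [_ [l Hs]].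
  rewrite (coeff_eq f a Ha) in Hs.
  unfold HE_norm. rewrite (coeff_eq f a Ha). fold (norm_terms a).
  rewrite (is_series_unique _ _ Hs), pow2_sqrt; [exact Hs|].
  (* The sum is a limit of nonnegative partial sums, so squaring undoes the square root. *)
  apply (is_lim_seq_le (fun _ => 0) (sum_n (norm_terms a)) 0 l).
  - intros n. rewrite sum_n_Reals. apply cond_pos_sum, norm_terms_ge_0.
  - apply is_lim_seq_const.
  - exact Hs.
Qed.

Lemma HE_inner_self (f : C -> C) :
  in_HE xi f -> HE_inner xi f f = RtoC (HE_norm xi f ^ 2).
Proof.
  intros Hf. destruct (in_HE_coeff f Hf) as [Ha _].
  apply CSeries_unique.
  generalize (is_series_RtoC _ _ (HE_norm_sqr f _ Hf Ha)).
  apply is_series_ext. intros n. unfold norm_terms.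
  now rewrite RtoC_mult, Cmod2_conj.
Qed.

Lemma HE_norm_ext (f g : C -> C) :
  (forall n, Cmod (coeff f n) = Cmod (coeff g n)) ->
  HE_norm xi f = HE_norm xi g.
Proof.
  intros H. unfold HE_norm. f_equal. apply Series_ext. intros n. now rewrite H.
Qed.

(** $\|Sf\|^2=\langle Sf,Sf\rangle=\langle f,TSf\rangle=\langle f,f\rangle$. The pointwise equality
    of $TSf$ and $f$ suffices, since the inner product sees only coefficients. *)
Lemma unitary_isometry (S : (C -> C) -> C -> C) :
  unitary xi S -> isometry xi S.
Proof.
  intros [HS [T [[_ Hadj] [HTS _]]]]. split; [exact HS|]. intros f Hf.
  assert (HSf : in_HE xi (S f)) by now apply HS.
  assert (H : RtoC (HE_norm xi (S f) ^ 2) = RtoC (HE_norm xi f ^ 2)).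
  { rewrite <- !HE_inner_self by assumption. rewrite Hadj by assumption.
    unfold HE_inner. replace (coeff (T (S f))) with (coeff f); [reflexivity|].
    symmetry. apply coeff_eq, (has_expansion_ext f).
    - intros z. symmetry. now apply HTS.
    - now apply in_HE_coeff. }
  apply RtoC_inj in H. rewrite <- !Rsqr_pow2 in H.
  apply Rsqr_inj; [apply sqrt_pos | apply sqrt_pos | exact H].
Qed.

(** * Rotations of the variable as unitary operators *)

Lemma in_HE_rotate (f : C -> C) (mu : C) :
  Cmod mu = 1 -> in_HE xi f -> in_HE xi (fun z => f (Cmult mu z)).
Proof.
  intros Hmu [a [Ha Hs]].
  exists (fun n => Cmult (a n) (Cpow mu n)). split.
  - now apply has_expansion_rotate.
  - revert Hs. apply ex_series_ext. intros n.
    now rewrite Cmod_mult, Cmod_pow, Hmu, pow1, Rmult_1_r.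
Qed.

Lemma coeff_rotate (f : C -> C) (mu : C) :
  in_HE xi f ->
  coeff (fun z => f (Cmult mu z)) = fun n => Cmult (coeff f n) (Cpow mu n).
Proof.
  intros Hf. apply coeff_eq, has_expansion_rotate. now apply in_HE_coeff.
Qed.

Lemma HE_norm_rotate (f : C -> C) (mu : C) :
  Cmod mu = 1 -> in_HE xi f ->
  HE_norm xi (fun z => f (Cmult mu z)) = HE_norm xi f.
Proof.
  intros Hmu Hf. apply HE_norm_ext. intros n. rewrite coeff_rotate by exact Hf.
  now rewrite Cmod_mult, Cmod_pow, Hmu, pow1, Rmult_1_r.
Qed.

Lemma bounded_operator_rotate (mu : C) :
  Cmod mu = 1 -> bounded_operator xi (fun f z => f (Cmult mu z)).
Proof.
  intros Hmu. split; [|split].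
  - intros f Hf. now apply in_HE_rotate.
  - reflexivity.
  - exists 1. intros f Hf. rewrite HE_norm_rotate by assumption. lra.
Qed.

Lemma rotate_conj (f : C -> C) (mu z : C) :
  Cmod mu = 1 -> f (Cmult mu (Cmult (Cconj mu) z)) = f z.
Proof.
  intros Hmu. f_equal.
  replace (Cmult mu (Cmult (Cconj mu) z)) with (Cmult (Cmult mu (Cconj mu)) z)
    by ring.
  rewrite <- Cmod2_conj, Hmu, pow1. apply Cmult_1_l.
Qed.

Lemma isometry_rotation (S : (C -> C) -> C -> C) (mu : C) :
  Cmod mu = 1 -> bounded_operator xi S ->
  (forall f z, S f z = f (Cmult mu z)) -> isometry xi S.
Proof.
  intros Hmu HS HSeq. split; [exact HS|]. intros f Hf.
  replace (S f) with (fun z => f (Cmult mu z)).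
  - now apply HE_norm_rotate.
  - apply functional_extensionality. intros z. now rewrite HSeq.
Qed.

Lemma unitary_rotation (S : (C -> C) -> C -> C) (mu : C) :
  Cmod mu = 1 -> bounded_operator xi S ->
  (forall f z, S f z = f (Cmult mu z)) -> unitary xi S.
Proof.
  intros Hmu HS HSeq. split; [exact HS|].
  assert (Hmu' : Cmod (Cconj mu) = 1) by now rewrite Cmod_conj.
  exists (fun f z => f (Cmult (Cconj mu) z)). split; [split|split].
  - now apply bounded_operator_rotate.
  - intros f g Hf Hg.
    replace (S f) with (fun z => f (Cmult mu z)).
    2: { apply functional_extensionality. intros z. now rewrite HSeq. }
    (* Termwise, the factor $\mu^n$ on the left equals the conjugate of the factor
       $\overline{\mu}^n$ on the right. *)
    unfold HE_inner. rewrite !coeff_rotate by assumption.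
    f_equal. apply functional_extensionality. intros n.
    rewrite Cmult_conj, Cpow_conj, Cconj_conj. ring.
  - intros f Hf z. rewrite HSeq. now apply rotate_conj.
  - intros f Hf z. rewrite HSeq.
    rewrite <- (rotate_conj f (Cconj mu) z Hmu'), Cconj_conj. reflexivity.
Qed.

(** * The power series of the kernel *)

Definition kernel_coeff (c : C) (n : nat) : C :=
  Cmult (RtoC (/ xi n ^ 2)) (Cpow (Cconj c) n).

(** With $r=\xi_n^{1/n}$ and $q=|c||z|$ the $n$-th term has modulus $(q/r^2)^n$, which is eventually
    at most $2^{-n}$. *)
Lemma has_expansion_kernel (c : C) :
  is_lim_seq (fun n => Rpower (xi n) (/ INR n)) p_infty ->
  has_expansion (HE_kernel xi c) (kernel_coeff c).
Proof.
  intros Hlim z.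
  assert (Hex : ex_series (V := C_CompleteNormedModule)
    (fun n => Cmult (kernel_coeff c n) (Cpow z n))).
  { set (q := Cmod c * Cmod z).
    assert (Hq : 0 <= q) by (apply Rmult_le_pos; apply Cmod_ge_0).
    (* Once $r>q+1$, one has $r>0$ and $r^2\geq (q+1)^2\geq 2q$. *)
    destruct (proj2 (is_lim_seq_spec _ _) Hlim (q + 1)) as [N HN].
    (* Starting at [S N] rather than [N] keeps the index positive, so that the $n$-th root is
       genuine. *)
    apply (ex_series_incr_n _ (S N)).
    apply (ex_series_le (V := C_CompleteNormedModule) _
             (fun n => (/ 2) ^ S N * (/ 2) ^ n)).
    - intros k. rewrite <- pow_add. set (n := (S N + k)%nat).
      assert (Hroot := HN n ltac:(unfold n; lia)).
      set (r := Rpower (xi n) (/ INR n)) in Hroot.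
      assert (Hn : 0 < INR n) by (apply lt_0_INR; unfold n; lia).
      assert (Hxi : xi n = r ^ n).
      { rewrite <- Rpower_pow by lra. unfold r. rewrite Rpower_mult.
        rewrite Rinv_l, Rpower_1; auto; lra. }
      change (Cmod (Cmult (kernel_coeff c n) (Cpow z n)) <= (/ 2) ^ n).
      unfold kernel_coeff.
      rewrite !Cmod_mult, !Cmod_pow, Cmod_conj, Cmod_R, Rabs_pos_eq
        by (apply Rlt_le, Rinv_0_lt_compat, pow_lt, xi_pos).
      rewrite Hxi, Rmult_assoc, <- Rpow_mult_distr. fold q.
      rewrite <- pow_mult, Nat.mul_comm, pow_mult, <- pow_inv,
        <- Rpow_mult_distr.
      assert (Hr : 0 < r ^ 2) by (apply pow_lt; lra).
      apply pow_incr. split.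
      + apply Rmult_le_pos; [apply Rlt_le, Rinv_0_lt_compat, Hr | exact Hq].
      + apply (Rmult_le_reg_l (r ^ 2)); [exact Hr|].
        rewrite <- Rmult_assoc, Rinv_r by lra. nra.
    - apply (ex_series_scal_l (V := R_NormedModule) ((/ 2) ^ S N)), ex_series_geom.
      rewrite Rabs_pos_eq; lra. }
  destruct Hex as [l Hl].
  replace (HE_kernel xi c z) with l; [exact Hl|].
  symmetry. exact (CSeries_unique _ l Hl).
Qed.

(** * Norms of the test functions $1+tz$ and of their images *)

Lemma norm_terms_affine_delta (t : C) :
  is_series (norm_terms (affine_coeff t delta))
    (xi 0%nat ^ 2 + Cmod t ^ 2 * xi 1%nat ^ 2).
Proof.
  replace (xi 0%nat ^ 2) with (norm_terms (affine_coeff t delta) 0).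
  2: { unfold norm_terms, affine_coeff, delta.
       rewrite Cmult_0_r, Cplus_0_r, Cmod_1. ring. }
  replace (Cmod t ^ 2 * xi 1%nat ^ 2)
    with (norm_terms (affine_coeff t delta) 1).
  2: { unfold norm_terms, affine_coeff, delta.
       now rewrite Cmult_1_r, Cplus_0_l. }
  apply is_series_first_two. intros n. unfold norm_terms, affine_coeff, delta.
  rewrite Cmult_0_r, Cplus_0_r, Cmod_0. ring.
Qed.

(** The operator sends $1+tz$ to $K_c(z)(1+t\mu z)$, and both have the same norm. All the necessary
    conditions are extracted from this one family of equations in $t$. *)
Lemma isometry_affine_norm (mu c : C) (Upsilon Phi : C -> C) :
  is_lim_seq (fun n => Rpower (xi n) (/ INR n)) p_infty ->
  (forall z, Upsilon z = HE_kernel xi c z) ->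
  (forall z, Phi z = Cmult mu z) ->
  isometry xi (weighted_comp Upsilon Phi) ->
  forall t,
    is_series (norm_terms (affine_coeff (Cmult t mu) (kernel_coeff c)))
      (xi 0%nat ^ 2 + Cmod t ^ 2 * xi 1%nat ^ 2).
Proof.
  intros Hlim HU HPhi [[Hin _] Hiso] t.
  (* The factor 1 gives [f] the shape of [has_expansion_affine] applied to the constant function
     1. *)
  set (f := fun z => Cmult (RtoC 1) (Cplus (RtoC 1) (Cmult t z))).
  assert (Hexp : has_expansion f (affine_coeff t delta))
    by apply (has_expansion_affine _ _ t has_expansion_one).
  assert (Hf : in_HE xi f).
  { exists (affine_coeff t delta). split; [exact Hexp|].
    eexists. apply norm_terms_affine_delta. }
  assert (Hnorm : HE_norm xi f ^ 2 = xi 0%nat ^ 2 + Cmod t ^ 2 * xi 1%nat ^ 2).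
  { rewrite <- (is_series_unique _ _ (HE_norm_sqr f _ Hf Hexp)).
    apply is_series_unique, norm_terms_affine_delta. }
  rewrite <- Hnorm, <- (Hiso f Hf).
  apply HE_norm_sqr; [now apply Hin|].
  apply (has_expansion_ext
    (fun z => Cmult (HE_kernel xi c z) (Cplus (RtoC 1) (Cmult (Cmult t mu) z)))).
  - intros z. unfold weighted_comp, f. rewrite HU, HPhi. ring.
  - now apply has_expansion_affine, has_expansion_kernel.
Qed.

Lemma parallelogram_difference (u v : C) :
  Cmod (Cplus u v) ^ 2 - Cmod (Cplus u (Copp v)) ^ 2
  = 4 * Re (Cmult u (Cconj v)).
Proof. rewrite !Cmod2_alt. unfold Re, Im; simpl. ring. Qed.

(* Termwise, the difference of the two series is
   [4 Re (k_(n+1) conj (conj c k_n)) xi_(n+1)^2 = 4 |c|^(2n+2) / xi_n^2 >= 0],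
   where [k_n] are the coefficients of [K_c]. *)
Lemma kernel_shift_norms_eq (c : C) (l : R) :
  is_series (norm_terms (affine_coeff (Cconj c) (kernel_coeff c))) l ->
  is_series (norm_terms (affine_coeff (Copp (Cconj c)) (kernel_coeff c))) l ->
  c = RtoC 0.
Proof.
  intros Hp Hm.
  set (k := kernel_coeff c).
  set (d := fun n => norm_terms (affine_coeff (Cconj c) k) n
                   - norm_terms (affine_coeff (Copp (Cconj c)) k) n).
  assert (Hd : is_series d 0).
  { replace 0 with (plus l (opp l)) by (unfold plus, opp; simpl; ring).
    exact (is_series_minus _ _ _ _ Hp Hm). }
  assert (HS : forall n, d (S n) = 4 * (Cmod c ^ 2 * Cmod (Cpow c n) ^ 2 / xi n ^ 2)).
  { intros n. unfold d, norm_terms. rewrite <- Rmult_minus_distr_r.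
    unfold affine_coeff. simpl (match S n with O => _ | S _ => _ end).
    replace (Cmult (Copp (Cconj c)) (k n)) with (Copp (Cmult (Cconj c) (k n)))
      by ring.
    rewrite parallelogram_difference.
    replace (Cmult (k (S n)) (Cconj (Cmult (Cconj c) (k n))))
      with (RtoC (/ xi (S n) ^ 2 * / xi n ^ 2 * (Cmod c ^ 2 * Cmod (Cpow c n) ^ 2))).
    2: { unfold k, kernel_coeff. rewrite !RtoC_mult, !Cmod2_conj, !Cpow_S.
         rewrite !Cmult_conj, !Cpow_conj, !Cconj_conj.
         replace (Cconj (RtoC (/ xi n ^ 2))) with (RtoC (/ xi n ^ 2))
           by (unfold Cconj, RtoC; simpl; f_equal; ring).
         ring. }
    rewrite re_RtoC. field. split; apply Rgt_not_eq, xi_pos. }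
  (* The term of index 1 is $4|c|^2/\xi_0^2$, so its vanishing already gives $c=0$. The term of
     index 0 is zero because the shifted sequence starts with 0. *)
  assert (H1 : d 1%nat = 0).
  { apply nonneg_series_zero; [|exact Hd]. intros [|n].
    - unfold d, norm_terms, affine_coeff. rewrite !Cmult_0_r. lra.
    - rewrite HS. apply Rmult_le_pos; [lra|].
      apply Rdiv_le_0_compat; [|apply pow_lt, xi_pos].
      apply Rmult_le_pos; apply pow2_ge_0. }
  rewrite HS in H1. simpl Cpow in H1. rewrite Cmod_1 in H1.
  apply Cmod_eq_0.
  assert (H0 := xi_pos 0).
  assert (Hc : Cmod c ^ 2 = 0).
  { replace (Cmod c ^ 2)
      with (4 * (Cmod c ^ 2 * 1 ^ 2 / xi 0%nat ^ 2) * (xi 0%nat ^ 2 / 4))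
      by (field; lra).
    rewrite H1. ring. }
  nra.
Qed.

(** $K_0$ is the constant $1/\xi_0^2$, so this is the squared norm of $1+sz$ scaled by
    $\xi_0^{-4}$. *)
Lemma norm_terms_affine_kernel_0 (s : C) :
  is_series (norm_terms (affine_coeff s (kernel_coeff (RtoC 0))))
    ((xi 0%nat ^ 2 + Cmod s ^ 2 * xi 1%nat ^ 2) / xi 0%nat ^ 4).
Proof.
  assert (Hk0 := xi_pos 0).
  assert (Hconj : Cconj (RtoC 0) = RtoC 0)
    by (unfold Cconj, RtoC; simpl; f_equal; ring).
  generalize (is_series_scal (/ xi 0%nat ^ 4) _ _ (norm_terms_affine_delta s)).
  replace (scal _ _)
    with ((xi 0%nat ^ 2 + Cmod s ^ 2 * xi 1%nat ^ 2) / xi 0%nat ^ 4)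
    by (unfold scal; simpl; unfold mult; simpl; field; lra).
  apply is_series_ext. intros n. unfold norm_terms.
  replace (affine_coeff s (kernel_coeff (RtoC 0)) n)
    with (Cmult (RtoC (/ xi 0%nat ^ 2)) (affine_coeff s delta n)).
  2: { unfold affine_coeff, kernel_coeff. rewrite Hconj.
       destruct n as [|[|n]]; simpl; ring. }
  rewrite Cmod_mult, Cmod_R, Rabs_pos_eq.
  - change scal with Rmult. apply Rminus_diag_uniq. field. lra.
  - apply Rlt_le, Rinv_0_lt_compat. nra.
Qed.

(** * Necessary conditions for an isometry, and the converse reduction to a rotation *)

Lemma isometry_conditions (mu c : C) (Upsilon Phi : C -> C) :
  is_lim_seq (fun n => Rpower (xi n) (/ INR n)) p_infty ->
  (forall z, Upsilon z = HE_kernel xi c z) ->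
  (forall z, Phi z = Cmult mu z) ->
  isometry xi (weighted_comp Upsilon Phi) ->
  Cmod mu = 1 /\ c = RtoC 0 /\ xi 0%nat = 1.
Proof.
  intros Hlim HU HPhi Hiso.
  assert (E := isometry_affine_norm mu c _ _ Hlim HU HPhi Hiso).
  assert (H0 := xi_pos 0). assert (H1 := xi_pos 1).
  assert (E0 := E (RtoC 0)). assert (E1 := E (RtoC 1)).
  rewrite Cmult_0_l, Cmod_0 in E0. rewrite Cmult_1_l, Cmod_1 in E1.
  (* If $\mu=0$, the functions $1$ and $1+z$ have the same image, although their squared norms
     differ by $\xi_1^2>0$. *)
  assert (Hmu : mu <> RtoC 0).
  { intros Hmu. rewrite Hmu in E1.
    assert (H := is_series_unique _ _ E0).
    rewrite (is_series_unique _ _ E1) in H. nra. }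
  assert (Hc : c = RtoC 0).
  { apply (kernel_shift_norms_eq c
             (xi 0%nat ^ 2 + Cmod (Cdiv (Cconj c) mu) ^ 2 * xi 1%nat ^ 2)).
    - generalize (E (Cdiv (Cconj c) mu)).
      replace (Cmult (Cdiv (Cconj c) mu) mu) with (Cconj c); [auto|].
      now field.
    - generalize (E (Copp (Cdiv (Cconj c) mu))).
      rewrite Cmod_opp.
      replace (Cmult (Copp (Cdiv (Cconj c) mu)) mu) with (Copp (Cconj c));
        [auto|].
      now field. }
  subst c.
  (* Each image norm is now known in two ways: $t=0$ yields $\xi_0^4=1$, and then $t=1$ yields
     $\xi_1^2=|\mu|^2\xi_1^2$. *)
  assert (F0 := is_series_unique _ _ (norm_terms_affine_kernel_0 (RtoC 0))).
  assert (F1 := is_series_unique _ _ (norm_terms_affine_kernel_0 mu)).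
  rewrite (is_series_unique _ _ E0), Cmod_0 in F0.
  rewrite (is_series_unique _ _ E1) in F1.
  assert (Hxi : xi 0%nat = 1).
  { assert (Hx : (xi 0%nat ^ 2) ^ 2 = 1).
    { transitivity ((xi 0%nat ^ 2 + 0 ^ 2 * xi 1%nat ^ 2) * xi 0%nat ^ 2);
        [ring|]. rewrite F0. field. lra. }
    apply pow2_eq_1; [lra|]. apply pow2_eq_1; [apply pow2_ge_0 | exact Hx]. }
  split; [|now split].
  rewrite Hxi in F1. assert (Hmod := Cmod_ge_0 mu).
  assert (Hm : Cmod mu ^ 2 = 1).
  { apply (Rmult_eq_reg_r (xi 1%nat ^ 2)); [|apply Rgt_not_eq, pow_lt, H1].
    lra. }
  now apply pow2_eq_1.
Qed.

(** The weight $K_0$ is the constant $1/\xi_0^2=1$, so only the composition with $\mu z$ remains. *)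
Lemma weighted_comp_rotation (mu : C) (Upsilon Phi : C -> C) :
  is_lim_seq (fun n => Rpower (xi n) (/ INR n)) p_infty ->
  (forall z, Upsilon z = HE_kernel xi (RtoC 0) z) ->
  (forall z, Phi z = Cmult mu z) ->
  xi 0%nat = 1 ->
  forall f z, weighted_comp Upsilon Phi f z = f (Cmult mu z).
Proof.
  intros Hlim HU HPhi Hxi f z. unfold weighted_comp. rewrite HPhi, HU.
  replace (HE_kernel xi (RtoC 0) z) with (RtoC 1); [apply Cmult_1_l|].
  symmetry. apply CSeries_unique.
  generalize (has_expansion_one z). apply is_series_ext.
  intros [|n]; simpl.
  - rewrite Hxi. replace (/ (1 * (1 * 1))) with 1 by field. ring.
  - replace (Cconj (RtoC 0)) with (RtoC 0); [ring|].
    unfold Cconj, RtoC; simpl; f_equal; ring.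
Qed.

End HE.

Theorem theorem3p5 (xi : nat -> R)
  (xi_pos : forall n, 0 < xi n)
  (xi_lim : is_lim_seq (fun n => Rpower (xi n) (/ INR n)) p_infty)
  (mu c : C) (mu_le1 : Cmod mu <= 1)
  (Upsilon Phi : C -> C)
  (Upsilon_def : forall z, Upsilon z = HE_kernel xi c z)
  (Phi_def : forall z, Phi z = Cmult mu z)
  (bounded : bounded_operator xi (weighted_comp Upsilon Phi)) :
  (isometry xi (weighted_comp Upsilon Phi) <->
     Cmod mu = 1 /\ c = RtoC 0 /\ xi 0%nat = 1) /\
  (unitary xi (weighted_comp Upsilon Phi) <->
     Cmod mu = 1 /\ c = RtoC 0 /\ xi 0%nat = 1).
Proof.
  assert (Hnec := isometry_conditions xi xi_pos mu c _ _ xi_lim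
                    Upsilon_def Phi_def).
  split; split.
  - exact Hnec.
  - intros [Hmu [-> Hxi]]. apply (isometry_rotation xi _ mu Hmu bounded).
    now apply (weighted_comp_rotation xi).
  - intros HU. now apply Hnec, unitary_isometry.
  - intros [Hmu [-> Hxi]]. apply (unitary_rotation xi _ mu Hmu bounded).
    now apply (weighted_comp_rotation xi).
Qed.
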